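(* Let $G$ be the split special orthogonal group $\mathrm{SO}_{2m+1}$ ($m\ge1$), $\mu=(1,0,\dots,0)\in\mathbf Z^m\cong\mathbb X_*(T)$ and $\eta=x_1^{2m}$. Then $$\nabla^\eta_\mu(e_i^{(2)})=-4\,e_i^{(2)}\qquad\text{for all }i=1,2,\dots,m.$$ In particular, the eigenweights (eigenvalues of the endomorphism $\overline\nabla^\eta_\mu$ of $R^W_+/(R^W_+)^2$ induced by $\nabla^\eta_\mu$) are all equal to $-4$.
   Context: The base field has characteristic $p\ne2$. $R=H^*(\mathbb BT)=\overline{\mathbf Q}_\ell[x_1,\dots,x_m]$ with $x_i$ in degree 2 the standard coordinates on the maximal torus, $W=(\mathbf Z/2)^m\rtimes S_m$ acting by permutations and sign changes, $R^W=\overline{\mathbf Q}_\ell[e_1^{(2)},\dots,e_m^{(2)}]$ with $e_i^{(2)}$ the $i$th elementary symmetric polynomial in $x_1^2,\dots,x_m^2$. $W_\mu$ is the stabilizer of $\mu$, $P_\mu$ the parabolic whose roots $\alpha$ satisfy $\langle\alpha,\mu\rangle\ge0$, $\dim G/P_\mu=2m-1$, $H^*(\mathbb BP_\mu)=R^{W_\mu}$, $\partial_\mu=\partial_{x_1}$. $\int_{G/P_\mu}:R^{W_\mu}\to R^W$ is pushforward along $\mathbb BP_\mu\to\mathbb BG$, explicitly $f\mapsto\sum_{w\in W/W_\mu}w(f/\mathfrak R_\mu)$ with $\mathfrak R_\mu=\prod_{\alpha:\langle\alpha,\mu\rangle<0}\alpha=-x_1\prod_{j=2}^m(x_j-x_1)(-x_j-x_1)$.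 $\nabla^\eta_\mu:R^W\to R^W$ is the degree-preserving derivation $f\mapsto\int_{G/P_\mu}\eta\cdot\partial_\mu f$. *)

(* Defs.v *)
From HB Require Import structures.
From mathcomp Require Import all_boot all_order all_fingroup all_algebra.
From mathcomp Require Import mpoly.
(* Only used to make the ideal (R^W_+)^2 a boolean predicate. *)
From mathcomp Require boolp.

Set Implicit Arguments.
Unset Strict Implicit.
Unset Printing Implicit Defensive.
Import GRing.Theory.
Local Open Scope ring_scope.

(* The pair (e, s) stands for the element e s of (Z/2)^m ><| S_m, where e is
   the diagonal matrix with entries (-1)^(e i) and s permutes the standard
   basis: it maps the i-th basis vector to (-1)^(e (s i)) times the (s i)-th. *)
Definition weylB (m : nat) : Type := ({ffun 'I_m -> bool} * 'S_m)%type.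

HB.instance Definition _ (m : nat) := Finite.on (weylB m).

Section WeylGroup.
Variable m : nat.
Implicit Types u v w : weylB m.

(* 'S_m composes from left to right: (s * t)%g i = t (s i). *)
Definition weylB_mul u v : weylB m :=
  ([ffun k => u.1 k (+) v.1 ((u.2^-1)%g k)], (v.2 * u.2)%g).
Definition weylB_one : weylB m := ([ffun=> false], 1%g).
Definition weylB_inv u : weylB m := ([ffun k => u.1 (u.2 k)], (u.2^-1)%g).

Fact weylB_mulA : associative weylB_mul.
Proof.
move=> u v w; congr pair => /=; last by rewrite mulgA.
by apply/ffunP=> k; rewrite !ffunE /= addbA invMg permM.
Qed.

Fact weylB_mul1 : left_id weylB_one weylB_mul.
Proof.
case=> e s; congr pair => /=; last by rewrite mulg1.
by apply/ffunP=> k; rewrite !ffunE /= invg1 perm1.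
Qed.

Fact weylB_mulV : left_inverse weylB_one weylB_inv weylB_mul.
Proof.
case=> e s; congr pair => /=; last by rewrite mulgV.
by apply/ffunP=> k; rewrite !ffunE /= invgK addbb.
Qed.

HB.instance Definition _ :=
  Finite_isGroup.Build (weylB m) weylB_mulA weylB_mul1 weylB_mulV.

End WeylGroup.

(* Roots of SO_(2m+1), as row vectors of coordinates in the basis x_1, ..., x_m
   of the character lattice. *)
Definition rootsB (m : nat) : seq 'rV[int]_m :=
  let x (i : 'I_m) : 'rV[int]_m := delta_mx 0 i in
  let pairs := [seq ij : 'I_m * 'I_m <- enum {: 'I_m * 'I_m}
                  | (ij.1 < ij.2)%N] in
  [seq (-1) ^+ nat_of_bool a *: x i | i <- enum 'I_m, a <- enum {: bool}]
  ++ [seq (-1) ^+ nat_of_bool ab.1 *: x ij.1 + (-1) ^+ nat_of_bool ab.2 *: x ij.2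
        | ij <- pairs, ab <- enum {: bool * bool}].

(* Characters and cocharacters are rows of coordinates in dual bases. *)
Definition pairing (m : nat) (alpha mu : 'rV[int]_m) : int :=
  \sum_i alpha 0 i * mu 0 i.

Definition weylB_cochar (m : nat) (w : weylB m) (mu : 'rV[int]_m) :
  'rV[int]_m := \row_k ((-1) ^+ w.1 k * mu 0 ((w.2^-1)%g k)).

Definition stabB (m : nat) (mu : 'rV[int]_m) : {set weylB m} :=
  [set w | weylB_cochar w mu == mu].

Section Pushforward.
Variables (K : fieldType) (m : nat).
Local Notation R := {mpoly K[m]}.

Definition weylB_act (w : weylB m) (f : R) : R :=
  f \mPo [tuple (-1) ^+ w.1 (w.2 i) *: 'X_(w.2 i) | i < m].

Definition root_form (alpha : 'rV[int]_m) : R :=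
  \sum_i (alpha 0 i)%:~R *: 'X_i.

Definition negroots_prod (mu : 'rV[int]_m) : R :=
  \prod_(alpha <- rootsB m | pairing alpha mu < 0) root_form alpha.

Definition cochar_deriv (mu : 'rV[int]_m) (f : R) : R :=
  \sum_i (mu 0 i)%:~R *: f^`M(i).

(* Pushforward along BP_mu -> BG as an element of Frac(R). The sum runs over
   the left cosets w W_mu; for f in R^(W_mu), the only case of interest, its
   terms do not depend on the representatives. *)
Definition pushforward (mu : 'rV[int]_m) (f : R) : {fraction R} :=
  \sum_(C in lcosets (stabB mu) [set: weylB m])
     tofrac (weylB_act (repr C) f)
       / tofrac (weylB_act (repr C) (negroots_prod mu)).

End Pushforward.

Section Invariants.
Variables (K : fieldType) (m : nat).
Local Notation R := {mpoly K[m]}.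

Definition invariant : {pred R} :=
  [pred f : R | [forall w : weylB m, weylB_act w f == f]].

Fact weylB_act_is_linear (w : weylB m) : linear (@weylB_act K m w).
Proof. by move=> c f g; rewrite /weylB_act linearP. Qed.

Fact invariant_subalg : subalg_closed invariant.
Proof.
split.
- by apply/forallP=> w; rewrite /weylB_act rmorph1.
- move=> c f g /forallP hf /forallP hg; apply/forallP=> w.
  by rewrite weylB_act_is_linear (eqP (hf w)) (eqP (hg w)).
- move=> f g /forallP hf /forallP hg; apply/forallP=> w.
  by rewrite /weylB_act rmorphM /= -!/(weylB_act w _) (eqP (hf w)) (eqP (hg w)).
Qed.

HB.instance Definition _ := GRing.isSubalgClosed.Build K R invariant
  invariant_subalg.

(* R^W, where R = H^*(BT) has its x_i in degree 1 rather than 2. *)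
Record invring : Type := InvRing {
  invring_val :> R;
  _ : invring_val \in invariant }.

HB.instance Definition _ := [isSub for invring_val].
HB.instance Definition _ := [Choice of invring by <:].
HB.instance Definition _ := [SubChoice_isSubAlgebra of invring by <:].
HB.instance Definition _ := [SubChoice_isSubComNzRing of invring by <:].

(* R^W_+ : the elements of R^W all of whose components have positive degree. *)
Definition augmentation : {pred invring} :=
  [pred f : invring | mcoeff 0%MM (val f) == 0].

Fact augmentation_submod : submod_closed augmentation.
Proof.
split=> [|c f g /eqP hf /eqP hg]; apply/eqP; first by rewrite /= mcoeff0.
by rewrite /= mcoeffD mcoeffZ hf hg mulr0 addr0.
Qed.

HB.instance Definition _ := GRing.isSubmodClosed.Build K invring augmentation
  augmentation_submod.

Record augideal : Type := AugIdeal {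
  augideal_val :> invring;
  _ : augideal_val \in augmentation }.

HB.instance Definition _ := [isSub for augideal_val].
HB.instance Definition _ := [Choice of augideal by <:].
HB.instance Definition _ := [SubChoice_isSubLmodule of augideal by <:].

(* (R^W_+)^2, the finite sums of products of two elements of R^W_+. *)
Definition in_augideal2 (f : augideal) : Prop :=
  exists s : seq (augideal * augideal),
    augideal_val f = \sum_(p <- s) augideal_val p.1 * augideal_val p.2.

Definition augideal2 : {pred augideal} :=
  [pred f : augideal | boolp.asbool (in_augideal2 f)].

Fact augideal2_submod : submod_closed augideal2.
Proof.
split=> [|c f g /boolp.asboolP [s hs] /boolp.asboolP [t ht]]; apply/boolp.asboolP.
  by exists [::]; rewrite big_nil.
exists ([seq (c *: p.1, p.2) | p <- s] ++ t).
transitivity (c *: augideal_val f + augideal_val g); first by [].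
rewrite big_cat big_map -ht hs scaler_sumr; congr (_ + _).
by apply: eq_bigr=> p _; rewrite -scalerAl.
Qed.

HB.instance Definition _ := GRing.isSubmodClosed.Build K augideal augideal2
  augideal2_submod.

(* R^W_+ / (R^W_+)^2, with its K-vector space structure. *)
Definition cotangent : Type := Quotient.quot augideal2.

HB.instance Definition _ := Choice.on cotangent.
HB.instance Definition _ := GRing.Zmodule.on cotangent.

Definition cotangent_pi (f : augideal) : cotangent := \pi_(cotangent)%qT f.

Lemma cotangent_pi_eq (f g : augideal) :
  cotangent_pi f = cotangent_pi g <-> f - g \in augideal2.
Proof.
by rewrite (Quotient.idealrBE augideal2); split=> /eqP.
Qed.

Lemma cotangent_piD : {morph cotangent_pi : f g / f + g}.
Proof. exact: Quotient.pi_add. Qed.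

Lemma cotangent_piK (x : cotangent) : cotangent_pi (generic_quotient.repr x) = x.
Proof. exact: generic_quotient.reprK. Qed.

Definition cotangent_scale (c : K) (x : cotangent) : cotangent :=
  cotangent_pi (c *: generic_quotient.repr x).

Lemma cotangent_piZ (c : K) (f : augideal) :
  cotangent_pi (c *: f) = cotangent_scale c (cotangent_pi f).
Proof.
apply/cotangent_pi_eq; rewrite -scalerBr rpredZ //.
by apply/cotangent_pi_eq; rewrite cotangent_piK.
Qed.

Fact cotangent_scaleA a b x :
  cotangent_scale a (cotangent_scale b x) = cotangent_scale (a * b) x.
Proof. by rewrite -[x]cotangent_piK -!cotangent_piZ scalerA. Qed.

Fact cotangent_scale1 : left_id 1 cotangent_scale.
Proof. by move=> x; rewrite -[x]cotangent_piK -cotangent_piZ scale1r. Qed.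

Fact cotangent_scaleDr : right_distributive cotangent_scale +%R.
Proof.
move=> a x y; rewrite -[x]cotangent_piK -[y]cotangent_piK.
by rewrite -cotangent_piD -!cotangent_piZ scalerDr cotangent_piD.
Qed.

Fact cotangent_scaleDl x : {morph cotangent_scale^~ x : a b / a + b}.
Proof.
move=> a b; rewrite -[x]cotangent_piK -!cotangent_piZ.
by rewrite scalerDl cotangent_piD.
Qed.

HB.instance Definition _ := GRing.Zmodule_isLmodule.Build K cotangent
  cotangent_scaleA cotangent_scale1 cotangent_scaleDr cotangent_scaleDl.

Definition esym2_poly (i : nat) : R :=
  mesym m K i \mPo [tuple 'X_j ^+ 2 | j < m].

Fact esym2_invariant i : esym2_poly i \in invariant.
Proof.
apply/forallP=> w; apply/eqP.
have E : esym2_poly i =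
    \sum_(h : {set 'I_m} | #|h| == i) \prod_(j in h) 'X_j ^+ 2.
  rewrite /esym2_poly /mesym rmorph_sum /=; apply: eq_bigr=> h _.
  rewrite rmorph_prod /=; apply: eq_bigr=> j _.
  by rewrite comp_mpolyXU -tnth_nth tnth_mktuple.
rewrite {1}E /weylB_act rmorph_sum /= E.
rewrite [RHS](reindex_inj (imset_inj (@perm_inj _ w.2))) /=.
apply: eq_big=> [h|h _]; first by rewrite card_imset //; apply: perm_inj.
rewrite rmorph_prod /= big_imset /=; last by move=> ? ? _ _; apply: perm_inj.
apply: eq_bigr=> j _; rewrite rmorphXn /= comp_mpolyXU -tnth_nth tnth_mktuple.
by rewrite exprZn sqrr_sign scale1r.
Qed.

Definition esym2 (i : nat) : invring := InvRing (esym2_invariant i).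

(* nabla is the map R^W -> R^W sending f to the pushforward of eta * d_mu f;
   this determines nabla uniquely, R embedding into its fraction field. *)
Definition is_nabla (mu : 'rV[int]_m) (eta : R) (nabla : invring -> invring) :
  Prop :=
  forall f : invring,
    tofrac (nabla f : R) = pushforward mu (eta * cochar_deriv mu (f : R)).

(* D preserves R^W_+, and E is the endomorphism of R^W_+ / (R^W_+)^2 that it
   induces. *)
Definition induced_on_cotangent (D : invring -> invring)
  (E : cotangent -> cotangent) : Prop :=
  forall f : augideal, exists2 g : augideal,
    augideal_val g = D f & E (cotangent_pi f) = cotangent_pi g.

End Invariants.

Definition is_basis (K : fieldType) (V : lmodType K) (n : nat) (b : 'I_n -> V) :
  Prop := forall v : V, exists! c : 'rV[K]_n, v = \sum_i c 0 i *: b i.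

(* V has finite dimension and s lists the eigenvalues of E in K, counted with
   their multiplicities as roots of the characteristic polynomial of E, which
   splits over K. *)
Definition eigenvalues_are (K : fieldType) (V : lmodType K) (E : V -> V)
  (s : seq K) : Prop :=
  exists (n : nat) (b : 'I_n -> V) (A : 'M[K]_n),
    [/\ is_basis b,
        forall j, E (b j) = \sum_i A i j *: b i
      & char_poly A = \prod_(a <- s) ('X - a%:P)].

(* Main.v *)
(** The cosets of W_mu in W correspond to the 2m images +-x_k of
    x_1.  On an invariant f the two signs give the same term, so
    with y_k = x_k^2 the operator is
      f |-> -4 \sum_k y_k^m (d f / d y_k) / \prod_(j <> k) (y_k - y_j).
    As d e_i / d y_k is the coefficient of z^(m - i) in
    \prod_(j <> k) (z + y_j), its value at e_i is read off from the identity
      \sum_k y_k^m \prod_(j <> k) ((z + y_j) / (y_k - y_j))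
        = \prod_j (z + y_j) - z^m,
    which holds because both sides have degree less than m in z and agree at the
    m points z = - y_k.  Since R^W is the polynomial ring on the e_i, the chain
    rule then gives the operator h(e) |-> -4 \sum_i e_i (d_i h)(e), which is -4
    on the linear part of h. *)

From HB Require Import structures.
Require Import Defs.
From mathcomp Require Import all_boot all_order all_fingroup all_algebra.
From mathcomp Require Import mpoly.
From mathcomp Require boolp.
From mathcomp Require Import ring.

Set Implicit Arguments.
Unset Strict Implicit.
Unset Printing Implicit Defensive.
Import GRing.Theory.
Local Open Scope ring_scope.

(** * Multivariate polynomials: chain rule, linear parts, squared variables *)

Section MultivariatePolynomials.
Variable K : comNzRingType.

Lemma comp_mpolyA (n k l : nat) (p : {mpoly K[n]}) (t : n.-tuple {mpoly K[k]})
    (u : k.-tuple {mpoly K[l]}) :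
  (p \mPo t) \mPo u = p \mPo [tuple tnth t i \mPo u | i < n].
Proof.
rewrite [p \mPo t]comp_mpolyE [RHS]comp_mpolyE rmorph_sum /=.
apply: eq_bigr=> a _; rewrite comp_mpolyZ rmorph_prod /=; congr (_ *: _).
by apply: eq_bigr=> i _; rewrite rmorphXn tnth_mktuple.
Qed.

Lemma mderivXU (n : nat) (i j : 'I_n) :
  ('X_j : {mpoly K[n]})^`M(i) = (j == i)%:R.
Proof.
rewrite mderivX mnm1E; case: eqP=> [->|_]; last by rewrite scale0r.
by rewrite -[X in (X - _)%MM]add0m addmK scale1r mpolyX0.
Qed.

(** Both sides are linear in [p] and obey the same Leibniz rule, so the identity need only be
    checked on variables. *)
Lemma mderiv_comp (n k : nat) (p : {mpoly K[n]}) (t : n.-tuple {mpoly K[k]})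
    (j : 'I_k) :
  (p \mPo t)^`M(j) = \sum_i (p^`M(i) \mPo t) * (tnth t i)^`M(j).
Proof.
pose Q p := (p \mPo t)^`M(j) = \sum_i (p^`M(i) \mPo t) * (tnth t i)^`M(j).
have Q0 : Q 0.
  rewrite /Q rmorph0 linear0 big1 // => i _.
  by rewrite linear0 rmorph0 mul0r.
have QD f g : Q f -> Q g -> Q (f + g).
  rewrite /Q rmorphD linearD /= => -> ->; rewrite -big_split /=.
  by apply: eq_bigr=> i _; rewrite linearD rmorphD mulrDl.
have QZ c f : Q f -> Q (c *: f).
  rewrite /Q linearZ /= mderivZ => ->; rewrite scaler_sumr.
  by apply: eq_bigr=> i _; rewrite mderivZ linearZ scalerAl.
have Q1 : Q 1.
  rewrite /Q rmorph1 -mpolyC1 mderivC big1 // => i _.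
  by rewrite mderivC rmorph0 mul0r.
have QM f g : Q f -> Q g -> Q (f * g).
  rewrite /Q rmorphM mderivM /= => -> ->; rewrite mulr_suml mulr_sumr.
  rewrite -big_split /=; apply: eq_bigr=> i _.
  by rewrite mderivM rmorphD !rmorphM /= mulrDl mulrAC mulrA.
have QX i : Q 'X_i.
  rewrite /Q comp_mpolyXU -tnth_nth (bigD1 i) //= mderivXU eqxx rmorph1 mul1r.
  rewrite big1 ?addr0 // => l li.
  by rewrite mderivXU eq_sym (negbTE li) rmorph0 mul0r.
rewrite -/(Q p) [p]mpolyE; elim/big_ind: _ => // a _; apply: QZ.
rewrite mpolyXE_id; elim/big_ind: _ => // i _.
by elim: (a i)=> [|e IH]; rewrite ?expr0 // exprS; apply: QM.
Qed.

(** Every monomial other than 1 is divisible by a variable. The coefficient of ['X_i] in [p] is then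
    the constant term of [q i]. *)
Lemma mpoly_decomp (n : nat) (p : {mpoly K[n]}) :
  exists q : 'I_n -> {mpoly K[n]}, p = (p@_0)%:MP + \sum_i 'X_i * q i.
Proof.
pose Q (p : {mpoly K[n]}) :=
  exists q : 'I_n -> {mpoly K[n]}, p = (p@_0)%:MP + \sum_i 'X_i * q i.
have QM f i : Q ('X_i * f).
  exists (fun j => if j == i then f else 0); rewrite rmorphM /= mcoeffX.
  rewrite mnm1_eq0 mul0r mpolyC0 add0r (bigD1 i) //= eqxx big1 ?addr0 //.
  by move=> j /negbTE ->; rewrite mulr0.
rewrite -/(Q p) [p]mpolyE; elim/big_ind: _ => [|f g [q eq] [r er]|a _].
- exists (fun=> 0); rewrite mcoeff0 mpolyC0 big1 ?addr0 // => i.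
  by rewrite mulr0.
- exists (fun i => q i + r i); rewrite {1}eq {1}er mcoeffD mpolyCD addrACA.
  by rewrite -big_split /=; congr (_ + _); apply: eq_bigr=> i _; rewrite mulrDr.
have [->|] := eqVneq a 0%MM.
  exists (fun=> 0); rewrite mpolyX0 mcoeffZ mcoeff1 eqxx mulr1.
  by rewrite alg_mpolyC big1 ?addr0 // => i; rewrite mulr0.
rewrite -mdeg_eq0 -lt0n mdegE lt0n sum_nat_eq0 negb_forall => /existsP[i].
move=> ai.
have ->: a = (U_(i) + (a - U_(i)))%MM by rewrite addmC submK // lep1mP.
by rewrite mpolyXD scalerAr.
Qed.

Lemma mcoeffU_mderiv (n : nat) (p : {mpoly K[n]}) (i : 'I_n) :
  p@_U_(i) = (p^`M(i))@_0.
Proof. by rewrite mcoeff_deriv add0m mnm0E mulr1n. Qed.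

(** Leibniz rule at the origin. In particular a product of two polynomials without constant term has
    no linear part. *)
Lemma mcoeffUM (n : nat) (p q : {mpoly K[n]}) (i : 'I_n) :
  (p * q)@_U_(i) = p@_U_(i) * q@_0 + p@_0 * q@_U_(i).
Proof. by rewrite !mcoeffU_mderiv mderivM rmorphD !rmorphM. Qed.

Definition square_vars (n : nat) : n.-tuple {mpoly K[n]} :=
  [tuple 'X_j ^+ 2 | j < n].

(** The substitution doubles the exponents of each monomial, and doubling is injective. *)
Lemma mcoeff_comp_square_vars (n : nat) (p : {mpoly K[n]}) (a : 'X_{1..n}) :
  (p \mPo square_vars n)@_(a *+ 2) = p@_a.
Proof.
rewrite comp_mpolyEX [in RHS](mpolyE p) !raddf_sum /=; apply: eq_bigr=> b _.
rewrite !mcoeffZ mcoeffX comp_mpolyX; congr (_ * _).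
under eq_bigr do rewrite tnth_mktuple -exprM mulnC exprM.
rewrite prodrXl -mpolyXE_id mpolyXn mcoeffX; congr (nat_of_bool _)%:R.
apply/eqP/eqP=> [|->//] /mnmP E; apply/mnmP=> i.
by have := E i; rewrite !mulmnE !muln2 => /double_inj.
Qed.

Lemma comp_square_vars_inj (n : nat) :
  injective (fun p : {mpoly K[n]} => p \mPo square_vars n).
Proof.
move=> p q E; apply/mpolyP=> a.
by rewrite -mcoeff_comp_square_vars E mcoeff_comp_square_vars.
Qed.

Lemma even_comp_square_vars (n : nat) (p : {mpoly K[n]}) :
  (forall (a : 'X_{1..n}) i, odd (a i) -> p@_a = 0) ->
  exists q : {mpoly K[n]}, p = q \mPo square_vars n.
Proof.
move=> hp.
exists (\sum_(a <- msupp p) p@_a *: 'X_[[multinom (a i)./2 | i < n]]).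
rewrite {1}[p]mpolyE rmorph_sum /=; apply: eq_big_seq=> a.
rewrite mcoeff_msupp comp_mpolyZ comp_mpolyX => ha; congr (_ *: _).
rewrite [LHS]mpolyXE_id; apply: eq_bigr=> i _.
rewrite tnth_mktuple mnmE -exprM mul2n; congr (_ ^+ _).
rewrite -[LHS]odd_double_half; case: (boolP (odd _)); rewrite ?add0n //.
by move/hp => E; rewrite E eqxx in ha.
Qed.

End MultivariatePolynomials.

(** * The invariant ring as the polynomial ring on the [e_i] *)

Section Invariants.
Variables (K : fieldType) (m : nat).
Local Notation R := {mpoly K[m]}.

Lemma weylB_actXU (w : weylB m) (i : 'I_m) :
  weylB_act w ('X_i : R) = (-1) ^+ w.1 (w.2 i) *: 'X_(w.2 i).
Proof. by rewrite /weylB_act comp_mpolyXU -tnth_nth tnth_mktuple. Qed.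

(** In the chain rule only the image of ['X_i] involves the variable of index [w.2 i]. *)
Lemma mderiv_weylB_act (w : weylB m) (f : R) (i : 'I_m) :
  (weylB_act w f)^`M(w.2 i) = (-1) ^+ w.1 (w.2 i) *: weylB_act w f^`M(i).
Proof.
rewrite /weylB_act mderiv_comp (bigD1 i) //= tnth_mktuple mderivZ mderivXU eqxx.
rewrite -scalerAr mulr1 big1 ?addr0 // => j ji.
rewrite tnth_mktuple mderivZ mderivXU (inj_eq perm_inj) (negbTE ji).
by rewrite scaler0 mulr0.
Qed.

Lemma invariant_act (f : R) (w : weylB m) :
  f \in @Defs.invariant K m -> weylB_act w f = f.
Proof. by move/forallP/(_ w)/eqP. Qed.

Definition esym2_tuple : m.-tuple R := [tuple esym2_poly K m i.+1 | i < m].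

Lemma esym2_tupleE (h : R) :
  h \mPo esym2_tuple =
    (h \mPo [tuple mesym m K i.+1 | i < m]) \mPo square_vars K m.
Proof.
rewrite comp_mpolyA; congr (_ \mPo _); apply: eq_from_tnth=> i.
by rewrite !tnth_mktuple.
Qed.

(** Algebraic independence of the [e_i], from that of the elementary symmetric polynomials and the
    injectivity of substituting squares. *)
Lemma comp_esym2_inj : injective (fun h : R => h \mPo esym2_tuple).
Proof.
move=> g h; rewrite !esym2_tupleE => /comp_square_vars_inj.
exact: msym_fundamental_un.
Qed.

Lemma comp_esym2_invariant (h : R) : h \mPo esym2_tuple \in @Defs.invariant K m.
Proof.
rewrite comp_mpolyE rpred_sum // => a _; apply/rpredZ/rpred_prod=> i _.
by rewrite rpredX // tnth_mktuple esym2_invariant.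
Qed.

Definition comp_esym2 (h : R) : invring K m :=
  InvRing (comp_esym2_invariant h).

Hypothesis char2 : (2%:R : K) != 0.

(** Changing the sign of [x_i] alone multiplies the coefficient at [a] by [(-1)^(a i)], so for odd
    [a i] it equals its own negative. *)
Lemma invariant_even (f : R) : f \in @Defs.invariant K m ->
  forall (a : 'X_{1..m}) i, odd (a i) -> f@_a = 0.
Proof.
move=> hf a i ai.
pose w : weylB m := ([ffun j => j == i], 1%g).
have E (b : 'X_{1..m}) : weylB_act w 'X_[b] = (-1) ^+ b i *: 'X_[b] :> R.
  rewrite mpolyXE_id /weylB_act rmorph_prod /=.
  rewrite (bigD1 i) // [in RHS](bigD1 i) //= scalerAl; congr (_ * _).
    rewrite rmorphXn /= -/(weylB_act w _) weylB_actXU ffunE perm1 eqxx expr1.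
    by rewrite exprZn.
  apply: eq_bigr=> j ji; rewrite rmorphXn /= -/(weylB_act w _) weylB_actXU.
  by rewrite ffunE perm1 (negbTE ji) scale1r.
have: (weylB_act w f)@_a = (-1) ^+ a i * f@_a.
  rewrite {1}[f]mpolyE /weylB_act rmorph_sum raddf_sum /=.
  rewrite [in RHS](mpolyE f) raddf_sum mulr_sumr /=; apply: eq_bigr=> b _.
  rewrite comp_mpolyZ -/(weylB_act w _) E !mcoeffZ mcoeffX mulrCA.
  by case: eqP=> [->|] //; rewrite !mulr0.
rewrite invariant_act // -signr_odd ai expr1 mulN1r => /eqP.
by rewrite -subr_eq0 opprK -mulr2n -mulr_natl mulf_eq0 (negbTE char2) => /eqP.
Qed.

(** Sign changes make [f] a polynomial [g] in the squares, permutations make [g] symmetric, and the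
    fundamental theorem on symmetric polynomials applies to [g]. *)
Lemma comp_esym2_surj (f : invring K m) : exists h, f = comp_esym2 h.
Proof.
case: f => f hf.
have [g fg] := even_comp_square_vars (invariant_even hf).
have symg : g \is symmetric.
  apply/issymP=> s; apply: comp_square_vars_inj; rewrite -fg.
  pose w : weylB m := ([ffun=> false], s).
  rewrite -[in RHS](invariant_act w hf) fg /weylB_act comp_mpolyA msym_mPo.
  congr (_ \mPo _); apply: eq_from_tnth=> i.
  rewrite !tnth_mktuple rmorphXn /= -/(weylB_act w _) weylB_actXU ffunE.
  by rewrite scale1r.
have [h [gh _]] := sym_fundamental symg.
by exists h; apply: val_inj; rewrite /= esym2_tupleE gh.
Qed.

End Invariants.

(** * The pushforward as a sum over the indices [k] *)

Section Pushforward.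
Variables (K : fieldType) (m : nat) (hm : (0 < m)%N).
Local Notation R := {mpoly K[m]}.
Local Notation one := (Ordinal hm).
Local Notation mu := (delta_mx 0 one : 'rV[int]_m).

Lemma root_formD (a b : 'rV[int]_m) :
  root_form K (a + b) = root_form K a + root_form K b.
Proof.
rewrite /root_form -big_split; apply: eq_bigr=> i _.
by rewrite mxE rmorphD scalerDl.
Qed.

Lemma root_form_signZ (b : bool) (i : 'I_m) :
  root_form K ((-1) ^+ b *: delta_mx 0 i) = (-1) ^+ b *: 'X_i.
Proof.
rewrite /root_form (bigD1 i) //= !mxE !eqxx mulr1 rmorph_sign big1 ?addr0 //.
by move=> j /negbTE ji; rewrite !mxE ji mulr0 scale0r.
Qed.

Lemma pairing_delta (a : 'rV[int]_m) (i : 'I_m) :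
  pairing a (delta_mx 0 i) = a 0 i.
Proof.
rewrite /pairing (bigD1 i) //= mxE !eqxx mulr1 big1 ?addr0 // => j /negbTE ji.
by rewrite mxE ji andbF mulr0.
Qed.

Lemma cochar_deriv_delta (i : 'I_m) (f : R) :
  cochar_deriv (delta_mx 0 i) f = f^`M(i).
Proof.
rewrite /cochar_deriv (bigD1 i) //= mxE !eqxx scale1r big1 ?addr0 //.
by move=> j /negbTE ji; rewrite mxE ji andbF scale0r.
Qed.

(** The negative roots are [-x_1] and the pairs [x_j - x_1], [-x_j - x_1], each pair having product
    [x_1^2 - x_j^2]. *)
Lemma negroots_prodE :
  negroots_prod K mu =
    - 'X_one * \prod_(j | j != one) ('X_one ^+ 2 - 'X_j ^+ 2).
Proof.
rewrite /negroots_prod /rootsB big_cat /=; congr (_ * _).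
  rewrite big_mkcond big_allpairs_dep big_enum /= (bigD1 one) //=.
  rewrite big_enum big_bool !root_form_signZ !pairing_delta !mxE !eqxx /=.
  rewrite mulr1 scaleN1r big1 ?mulr1 // => i ne_i.
  rewrite big_enum big_bool /= !pairing_delta !mxE /= eq_sym (negbTE ne_i).
  by rewrite !mulr0 mulr1.
pose r (i j : 'I_m) (ab : bool * bool) : 'rV[int]_m :=
  (-1) ^+ nat_of_bool ab.1 *: delta_mx 0 i
  + (-1) ^+ nat_of_bool ab.2 *: delta_mx 0 j.
pose g (i j : 'I_m) ab :=
  if pairing (r i j ab) mu < 0 then root_form K (r i j ab) else 1.
transitivity (\prod_(i < m) \prod_(j < m | (i < j)%N) \prod_ab g i j ab).
  rewrite big_mkcond big_allpairs_dep big_filter big_enum_cond pair_big_dep /=.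
  by apply: eq_bigr=> ij _; rewrite big_enum.
(* As [one] is the least index, it can only be the first entry of a pair; all other pairs give roots
   orthogonal to [mu]. *)
rewrite (bigD1 one) //= [X in _ * X]big1 ?mulr1.
  apply: eq_big=> [j|j lt0j]; first by rewrite lt0n.
  have ne_j : (one == j) = false.
    by rewrite -(inj_eq val_inj) /= eq_sym eqn0Ngt lt0j.
  rewrite -(pair_bigA _ (fun a b => g one j (a, b))) /g /r /=.
  rewrite !big_bool !root_formD !root_form_signZ.
  rewrite !pairing_delta !mxE !eqxx ne_j /=.
  rewrite !scaleN1r !scale1r !mulr1.
  by ring.
move=> i ne_i; rewrite big1 // => j lt_ij; rewrite big1 // => ab _.
rewrite /g /r.
have ne_j : (one == j) = false.
  by rewrite -(inj_eq val_inj) /=; case: (val j) lt_ij.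
by rewrite pairing_delta !mxE eq_sym (negbTE ne_i) ne_j !mulr0.
Qed.

Lemma weylB_act_negroots_prod (w : weylB m) :
  weylB_act w (negroots_prod K mu) = (-1) ^+ w.1 (w.2 one) *:
    (- 'X_(w.2 one) *
     \prod_(j | j != w.2 one) ('X_(w.2 one) ^+ 2 - 'X_j ^+ 2)).
Proof.
rewrite negroots_prodE /weylB_act rmorphM rmorphN rmorph_prod /=.
rewrite -/(weylB_act w _) weylB_actXU mulNr mulNr scalerN -scalerAl.
congr (- (_ *: (_ * _))).
rewrite [RHS](reindex_inj (@perm_inj _ w.2)) /=.
apply: eq_big=> [j|j _]; first by rewrite (inj_eq perm_inj).
rewrite rmorphB !rmorphXn /= -!/(weylB_act w _) !weylB_actXU.
by rewrite !exprZn !sqrr_sign !scale1r.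
Qed.

(** The common summand of the two cosets that send [x_1] to [x_k] or [-x_k]. *)
Definition pushforward_term (f : R) (k : 'I_m) : {fraction R} :=
  tofrac ('X_k ^+ (2 * m) * f^`M(k))
    / tofrac (- 'X_k * \prod_(j | j != k) ('X_k ^+ 2 - 'X_j ^+ 2)).

(** For invariant [f] the derivative acquires the same sign as the denominator, where squares absorb
    every sign but that of the linear factor. The even power of [x_1] acquires none. *)
Lemma pushforward_termE (f : R) (w : weylB m) : f \in @Defs.invariant K m ->
  tofrac (weylB_act w ('X_one ^+ (2 * m) * f^`M(one)))
    / tofrac (weylB_act w (negroots_prod K mu))
  = pushforward_term f (w.2 one).
Proof.
move=> hf; rewrite weylB_act_negroots_prod /pushforward_term.
have /(congr1 (GRing.scale ((-1) ^+ w.1 (w.2 one)))) :=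
  mderiv_weylB_act w f one.
rewrite invariant_act // scalerA -expr2 sqrr_sign scale1r => E.
rewrite {1}/weylB_act rmorphM rmorphXn /= -!/(weylB_act w _) -E weylB_actXU.
rewrite exprZn exprM sqrr_sign expr1n scale1r -scalerAr.
case: (w.1 _); last by rewrite !expr0 !scale1r.
by rewrite expr1 !scaleN1r !tofracN invrN mulrNN.
Qed.

Lemma stabB_deltaP (w : weylB m) :
  (w \in stabB mu) = (w.2 one == one) && ~~ w.1 one.
Proof.
rewrite inE; apply/eqP/andP=> [/rowP E|[/eqP w1 /negbTE w0]].
  have := E one; rewrite !mxE !eqxx /= (can2_eq (permKV _) (permK _)) eq_sym.
  by case: eqP => // _; rewrite ?mulr0 // mulr1; case: (w.1 one).
apply/rowP=> k; rewrite !mxE /= (can2_eq (permKV _) (permK _)) w1.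
by case: eqP=> [->|]; rewrite ?mulr0 // w0 mulr1.
Qed.

(** Encodes [w mu]: the pair of [k] and [b] stands for [(-1)^b] times the [k]-th basis vector. *)
Definition weylB_orbit (w : weylB m) : 'I_m * bool :=
  (w.2 one, w.1 (w.2 one)).

Lemma lcoset_stabB (x y : weylB m) :
  (y \in lcoset (stabB mu) x) = (weylB_orbit y == weylB_orbit x).
Proof.
rewrite lcosetE mem_lcoset.
have -> : (x^-1 * y)%g = weylB_mul (weylB_inv x) y by [].
rewrite stabB_deltaP /= permM ffunE /= invgK ffunE /weylB_orbit xpair_eqE.
rewrite (can2_eq (permKV _) (permK _)); case: eqP=> //= ->.
by rewrite [in RHS]eq_sym; case: (x.1 _); case: (y.1 _).
Qed.

(** Cosets correspond to pairs of an index and a sign; as [F] ignores the sign, each index counts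
    twice. *)
Lemma lcosets_stabB_sum (V : zmodType) (F : weylB m -> V) (g : 'I_m -> V) :
  (forall w, F w = g (w.2 one)) ->
  \sum_(C in lcosets (stabB mu) [set: weylB m]) F (repr C) = (\sum_k g k) *+ 2.
Proof.
(* [v] is a section of [weylB_orbit]: a transposition moves [one] to the index, and all signs are
   set to the given one. *)
move=> Fg; pose v (p : 'I_m * bool) : weylB m := ([ffun=> p.2], tperm one p.1).
have vK p : weylB_orbit (v p) = p.
  by case: p => k b; rewrite /weylB_orbit /= tpermL ffunE.
have FO w : F w = g (weylB_orbit w).1 by rewrite Fg.
have rK x : weylB_orbit (repr (lcoset (stabB mu) x)) = weylB_orbit x.
  apply/eqP; rewrite -lcoset_stabB (mem_repr x) //.
  by rewrite lcoset_stabB.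
rewrite (reindex_onto (fun p => lcoset (stabB mu) (v p))
  (fun C => weylB_orbit (repr C))) /=.
  rewrite (eq_bigl xpredT) => [|p]; last first.
    by rewrite rK vK eqxx andbT; apply: imset_f; rewrite inE.
  rewrite -(pair_bigA _ (fun k b => F (repr (lcoset (stabB mu) (v (k, b)))))).
  rewrite /= -sumrMnl; apply: eq_bigr=> k _.
  by rewrite big_bool /= !FO !rK !vK.
move=> C /imsetP[x _ ->]; apply/setP=> y.
by rewrite !lcoset_stabB vK rK.
Qed.

Lemma pushforwardE (f : R) : f \in @Defs.invariant K m ->
  pushforward mu ('X_one ^+ (2 * m) * cochar_deriv mu f)
  = (\sum_k pushforward_term f k) *+ 2.
Proof.
move=> hf; rewrite /pushforward cochar_deriv_delta.
pose F (w : weylB m) := tofrac (weylB_act w ('X_one ^+ (2 * m) * f^`M(one)))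
  / tofrac (weylB_act w (negroots_prod K mu)).
by apply: (lcosets_stabB_sum (F := F)) => w; apply: pushforward_termE.
Qed.

End Pushforward.

(** * Elementary symmetric polynomials and interpolation *)

Section ElementarySymmetric.

(** In the expanded product, [h] is the set of factors contributing their constant; the others
    contribute a power of ['X]. *)
Lemma coef_prod_XaddC (S : comNzRingType) (m i : nat) (y : 'I_m -> S) :
  (i <= m)%N ->
  (\prod_j ('X + (y j)%:P))`_(m - i)
    = \sum_(h : {set 'I_m} | #|h| == i) \prod_(j in h) y j.
Proof.
move=> le_im; under eq_bigr do rewrite addrC.
rewrite bigA_distr coef_sum [RHS]big_mkcond /=.
apply: eq_bigr=> h _; rewrite (bigID (mem h)) /=.
under eq_bigr => j -> do [].
under [X in _ * X]eq_bigr => j /negbTE -> do [].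
rewrite -rmorph_prod prodr_const coefCM coefXn.
have -> : #|[predC h]| = (m - #|h|)%N.
  by have /(congr1 (subn^~ #|h|)) := cardC (mem h); rewrite addKn card_ord.
have le_hm : (#|h| <= m)%N by have := max_card (mem h); rewrite card_ord.
have -> : (m - i == m - #|h|)%N = (#|h| == i).
  by apply/eqP/eqP=> [E|->//]; rewrite -(subKn le_hm) -E subKn.
by case: ifP; rewrite ?mulr1 ?mulr0.
Qed.

Lemma size_prod_XaddC (F : fieldType) (I : finType) (P : pred I) (y : I -> F) :
  size (\prod_(j | P j) ('X + (y j)%:P)) = #|P|.+1.
Proof.
rewrite size_prod => [|j _]; last exact/monic_neq0/monicXaddC.
under eq_bigr do rewrite size_XaddC.
by rewrite sum_nat_const muln2 -addnn subSn ?leq_addl // addnK.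
Qed.

(** Lagrange interpolation at the nodes [- y k]. *)
Lemma interpolation_prod_XaddC (F : fieldType) (m : nat) (y : 'I_m -> F) :
  injective y ->
  \sum_k (y k ^+ m / \prod_(j | j != k) (y k - y j))
      *: \prod_(j | j != k) ('X + (y j)%:P)
  = \prod_j ('X + (y j)%:P) - 'X^m.
Proof.
move=> y_inj; apply/eqP; rewrite -subr_eq0; apply/eqP.
set p := LHS.
apply: (roots_geq_poly_eq0 (rs := [seq - y k | k <- enum 'I_m])).
(* At [- y k] every product containing the factor of index [k] vanishes, which leaves one summand
   and the power of ['X]. *)
- apply/allP=> _ /mapP[k _ ->]; rewrite rootE /p hornerD hornerN horner_sum.
  rewrite [X in X - _](bigD1 k) //= [X in _ + X - _]big1 ?addr0 => [|l lk];
    last first.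
    have E : \prod_(j | j != l) ('X + (y j)%:P).[- y k] = 0.
      by rewrite (bigD1 k) 1?eq_sym //= !hornerE addNr mul0r.
    by rewrite hornerZ horner_prod E mulr0.
  have E : \prod_j ('X + (y j)%:P).[- y k] = 0.
    by rewrite (bigD1 k) //= !hornerE addNr mul0r.
  rewrite hornerZ hornerD hornerN hornerXn !horner_prod E sub0r opprK.
  (* The sign of these [m - 1] factors is opposite to the sign in [(- y k)^m], so the two remaining
     terms cancel. *)
  have -> : \prod_(j | j != k) ('X + (y j)%:P).[- y k] =
      (-1) ^+ m.-1 * \prod_(j | j != k) (y k - y j).
    rewrite -[m in m.-1]card_ord -(cardC1 k) -prodr_const -big_split /=.
    by apply: eq_bigr=> j _; rewrite !hornerE mulN1r opprB addrC.
  have nz : \prod_(j | j != k) (y k - y j) != 0.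
    by apply/prodf_neq0=> j jk; rewrite subr_eq0 (inj_eq y_inj) eq_sym.
  have m_gt0 : (0 < m)%N := leq_ltn_trans (leq0n k) (ltn_ord k).
  rewrite mulrCA -mulrA mulVf // mulr1 (exprNn (y k)) -mulrDl.
  by rewrite -[in X in _ + X](prednK m_gt0) exprS mulN1r subrr mul0r.
- by rewrite map_inj_uniq ?enum_uniq // => a b /oppr_inj /y_inj.
(* The full product is monic of degree [m], so subtracting ['X^m] removes its leading term. *)
rewrite size_map size_enum_ord; apply/leq_sizeP=> i le_mi.
have sizeP := size_prod_XaddC xpredT y; rewrite cardT size_enum_ord in sizeP.
have size_k (k : 'I_m) : (size (\prod_(j | j != k) ('X + (y j)%:P))%R <= m)%N.
  by rewrite size_prod_XaddC cardC1 card_ord prednK //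
    (leq_ltn_trans _ (ltn_ord k)).
rewrite /p coefB coef_sum big1 => [|k _]; last first.
  by rewrite coefZ nth_default ?mulr0 // (leq_trans (size_k k)).
rewrite coefB coefXn; move: le_mi; rewrite leq_eqVlt => /predU1P[<-|lt_mi].
  rewrite eqxx; have /monicP := monic_prod (index_enum 'I_m) (P := xpredT)
    (fun j _ => monicXaddC (y j)).
  by rewrite /lead_coef sizeP => ->; rewrite subrr subr0.
by rewrite gtn_eqF // nth_default ?sizeP // subrr subr0.
Qed.

End ElementarySymmetric.

(** * The operator on the [e_i] and on polynomials in them *)

Section Nabla.
Variables (K : fieldType) (m : nat).
Local Notation R := {mpoly K[m]}.

Local Notation prod_except k :=
  (\prod_(j < m | j != k) ('X + ('X_j ^+ 2 : R)%:P)).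

Lemma esym2_polyE (i : nat) : esym2_poly K m i =
  \sum_(h : {set 'I_m} | #|h| == i) \prod_(j in h) 'X_j ^+ 2.
Proof.
rewrite /esym2_poly /mesym rmorph_sum /=; apply: eq_bigr=> h _.
rewrite rmorph_prod /=; apply: eq_bigr=> j _.
by rewrite comp_mpolyXU -tnth_nth tnth_mktuple.
Qed.

Lemma esym2_polyE_coef (i : nat) : (i <= m)%N ->
  esym2_poly K m i = (\prod_(j < m) ('X + ('X_j ^+ 2 : R)%:P))`_(m - i).
Proof. by move=> le_im; rewrite coef_prod_XaddC // esym2_polyE. Qed.

Lemma mderiv_prod_except (k : 'I_m) (n : nat) : (prod_except k)`_n^`M(k) = 0.
Proof.
elim/big_rec: _ n => [|j p jk IH] n.
  by rewrite coef1; case: (n == 0)%N; rewrite ?mderiv0 // -mpolyC1 mderivC.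
rewrite mulrDl coefD mderivD coefXM coefCM mderivM IH mulr0 addr0.
rewrite expr2 mderivM mderivXU (negbTE jk) mul0r mulr0 add0r mul0r addr0.
by case: ifP; rewrite ?mderiv0.
Qed.

(** Only the factor of index [k] in the full product depends on [x_k], and its derivative is
    [2 x_k]. *)
Lemma mderiv_esym2_poly (k : 'I_m) (i : nat) : (i <= m)%N ->
  (esym2_poly K m i)^`M(k) = 'X_k *+ 2 * (prod_except k)`_(m - i).
Proof.
move=> le_im; rewrite esym2_polyE_coef // (bigD1 k) //= mulrDl coefD mderivD.
rewrite coefXM coefCM mderivM mderiv_prod_except mulr0 addr0.
rewrite expr2 mderivM mderivXU eqxx mul1r mulr1 -mulr2n.
by case: ifP; rewrite ?mderiv0 ?mderiv_prod_except add0r.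
Qed.

(** This is the coefficient at degree [m - i] of the interpolation identity over the fraction field,
    with [y_k = x_k^2]. *)
Lemma sum_pushforward_term_esym2 (i : nat) : (0 < i <= m)%N ->
  (\sum_k pushforward_term (esym2_poly K m i) k) *+ 2
  = tofrac (- esym2_poly K m i *+ 4).
Proof.
case/andP=> i_gt0 le_im.
pose y (k : 'I_m) : {fraction R} := tofrac ('X_k ^+ 2).
have y_inj : injective y.
  move=> j k /eqP; rewrite tofrac_eq => /eqP /(congr1 (mcoeff (U_(k) *+ 2)%MM)).
  rewrite !mpolyXn !mcoeffX eqxx; case: eqP => [/mnmP/(_ k)|_ /eqP].
    by rewrite !mulmnE !mnm1E eqxx; case: eqP.
  by rewrite eq_sym oner_eq0.
have coef_tofrac (P : pred 'I_m) n :
    tofrac (\prod_(j | P j) ('X + ('X_j ^+ 2 : R)%:P))`_n =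
    (\prod_(j | P j) ('X + (y j)%:P))`_n.
  rewrite -coef_map rmorph_prod.
  under eq_bigr do rewrite rmorphD /= map_polyX map_polyC.
  by [].
have E : tofrac (esym2_poly K m i) = \sum_k
    y k ^+ m / \prod_(j | j != k) (y k - y j)
      * tofrac (prod_except k)`_(m - i).
  rewrite esym2_polyE_coef // (coef_tofrac xpredT).
  have /polyP/(_ (m - i)%N) := interpolation_prod_XaddC y_inj.
  (* As [i] is positive, ['X^m] does not contribute at degree [m - i]. *)
  rewrite coefB coefXn ltn_eqF ?subr0 => [<-|]; last first.
    by rewrite ltn_subrL i_gt0 (leq_trans i_gt0).
  rewrite coef_sum; apply: eq_bigr=> k _; rewrite coefZ; congr (_ * _).
  exact/esym/coef_tofrac.
(* One factor 2 comes from the two signs, the other from the derivative of [x_k^2]. *)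
rewrite tofracMn tofracN E (mulrnA _ 2 2) -sumrN -!sumrMnl.
apply: eq_bigr=> k _; congr (_ *+ 2).
rewrite /pushforward_term mderiv_esym2_poly //.
have X0 : tofrac 'X_k != 0 :> {fraction R}.
  by rewrite tofrac_eq0 -msupp_eq0 msuppX.
have -> : tofrac (- 'X_k * \prod_(j < m | j != k) ('X_k ^+ 2 - 'X_j ^+ 2)) =
    - tofrac 'X_k * \prod_(j | j != k) (y k - y j) :> {fraction R}.
  rewrite tofracM tofracN rmorph_prod; congr (_ * _).
  by apply: eq_bigr=> j _; rewrite rmorphB.
have P0 : \prod_(j | j != k) (y k - y j) != 0.
  by apply/prodf_neq0=> j jk; rewrite subr_eq0 (inj_eq y_inj) eq_sym.
rewrite exprM [tofrac (_ ^+ m * _)]tofracM [tofrac (_ *+ 2 * _)]tofracM.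
rewrite [tofrac (_ ^+ m)]tofracXn [tofrac (_ *+ 2)]tofracMn.
(* The [x] from the derivative cancels against [- x] in the denominator, leaving the minus sign. *)
have aux (F : fieldType) (a x c p : F) : x != 0 -> p != 0 ->
    a * (x *+ 2 * c) / (- x * p) = - (a / p * c) *+ 2.
  by move=> x0 p0; field; rewrite oppr_eq0 x0 p0.
by rewrite -[tofrac ('X_k ^+ 2)]/(y k) aux.
Qed.

Lemma pushforward_term_comp_esym2 (h : R) (k : 'I_m) :
  pushforward_term (comp_esym2 h) k =
  \sum_(i < m) tofrac (comp_esym2 h^`M(i) : R)
    * pushforward_term (esym2_poly K m i.+1) k.
Proof.
rewrite /pushforward_term mderiv_comp mulr_sumr rmorph_sum mulr_suml.
apply: eq_bigr=> i _; rewrite mulrA -tofracM tnth_mktuple; congr (_ / _).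
by rewrite mulrCA.
Qed.

(** Minus four times the Euler operator, with every variable of weight 1: the operator on invariants
    transported along [comp_esym2]. *)
Definition nabla_comp_esym2 (h : R) : R := - (\sum_i 'X_i * h^`M(i)) *+ 4.

Lemma comp_esym2_XU (i : 'I_m) : comp_esym2 ('X_i : R) = esym2 K m i.+1.
Proof. by apply: val_inj; rewrite /= comp_mpolyXU -tnth_nth tnth_mktuple. Qed.

(** In the chain rule the partial derivatives of [h] at the [e_i] do not depend on [k], so the sum
    over [k] reduces to the case of a single [e_i]. *)
Lemma sum_pushforward_term_comp_esym2 (h : R) :
  (\sum_k pushforward_term (comp_esym2 h) k) *+ 2
  = tofrac (comp_esym2 (nabla_comp_esym2 h) : R).
Proof.
have -> : (comp_esym2 (nabla_comp_esym2 h) : R) =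
    \sum_i (comp_esym2 h^`M(i) : R) * (- esym2_poly K m i.+1 *+ 4).
  rewrite /= comp_mpolyMn comp_mpolyN rmorph_sum /= -sumrN -sumrMnl.
  apply: eq_bigr=> i _; rewrite rmorphM /= comp_mpolyXU -tnth_nth tnth_mktuple.
  by rewrite mulrnAr mulrN mulrC.
under eq_bigr do rewrite pushforward_term_comp_esym2.
rewrite exchange_big -sumrMnl rmorph_sum; apply: eq_bigr=> i _.
rewrite -mulr_sumr -mulrnAr sum_pushforward_term_esym2 ?ltn_ord //.
exact/esym/tofracM.
Qed.

End Nabla.

(** * The cotangent space and its basis *)

Section Cotangent.
Variables (K : fieldType) (m : nat).
Local Notation R := {mpoly K[m]}.

Fact comp_esym2_is_linear : linear (@comp_esym2 K m).
Proof. by move=> c f g; apply: val_inj; rewrite /= linearP. Qed.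

HB.instance Definition _ :=
  GRing.isLinear.Build K R (invring K m) _ (@comp_esym2 K m)
    comp_esym2_is_linear.

Fact comp_esym2_is_monoid_morphism : monoid_morphism (@comp_esym2 K m).
Proof.
by split=> [|f g]; apply: val_inj; rewrite /= ?rmorph1 ?rmorphM.
Qed.

HB.instance Definition _ :=
  GRing.isMonoidMorphism.Build R (invring K m) (@comp_esym2 K m)
    comp_esym2_is_monoid_morphism.

(** The substituted [e_i] have no constant term, so substitution preserves the constant term of
    [h]. *)
Lemma comp_esym2_augmentation (h : R) :
  (comp_esym2 h \in @augmentation K m) = (h@_0 == 0).
Proof.
have esym0 (i : nat) : (esym2_poly K m i.+1)@_0 = 0.
  rewrite esym2_polyE rmorph_sum big1 //= => s /eqP s_size.
  have /card_gt0P[j js] : (0 < #|s|)%N by rewrite s_size.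
  rewrite rmorph_prod (bigD1 j) //= rmorphXn /= mcoeffX mnm1_eq0.
  by rewrite expr0n mul0r.
have [q {1}->] := mpoly_decomp h.
rewrite /augmentation inE /= rmorphD rmorph_sum /= comp_mpolyC mcoeffD mcoeffC.
rewrite eqxx mulr1 raddf_sum big1 ?addr0 // => i _.
rewrite rmorphM /= rmorphM /= comp_mpolyXU -tnth_nth tnth_mktuple.
by rewrite esym0 mul0r.
Qed.

Fact esym2_augmentation (i : 'I_m) : esym2 K m i.+1 \in @augmentation K m.
Proof. by rewrite -comp_esym2_XU comp_esym2_augmentation mcoeffX mnm1_eq0. Qed.

Definition esym2_aug (i : 'I_m) : augideal K m :=
  AugIdeal (esym2_augmentation i).

Lemma augideal_val_sum (I : Type) (r : seq I) (F : I -> augideal K m) :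
  augideal_val (\sum_(i <- r) F i) = \sum_(i <- r) augideal_val (F i).
Proof. exact: (big_morph (@augideal_val K m)). Qed.

Lemma cotangent_pi_sum (I : Type) (r : seq I) (F : I -> augideal K m) :
  cotangent_pi (\sum_(i <- r) F i) = \sum_(i <- r) cotangent_pi (F i).
Proof.
apply: (big_morph (@cotangent_pi K m)); first exact: cotangent_piD.
rewrite -[X in cotangent_pi X](scale0r 0) cotangent_piZ; exact: scale0r.
Qed.

(** Writing [h] as the sum of the ['X_i * q i], replacing each [q i] by its constant term changes
    the result only by products of two elements of the ideal. *)
Lemma cotangent_pi_comp_esym2 (f : augideal K m) (h : R) :
  augideal_val f = comp_esym2 h ->
  cotangent_pi f = \sum_i h@_U_(i) *: cotangent_pi (esym2_aug i).
Proof.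
move=> fh; have h0 : h@_0 = 0.
  by apply/eqP; rewrite -comp_esym2_augmentation -fh; case: (f).
have [q hq] := mpoly_decomp h; rewrite h0 mpolyC0 add0r in hq.
have hU i : h@_U_(i) = (q i)@_0.
  rewrite {1}hq raddf_sum (bigD1 i) //= mcoeffUM mcoeffXU eqxx mul1r.
  rewrite mcoeffX mnm1_eq0 mul0r addr0 big1 ?addr0 // => j /negbTE ji.
  by rewrite mcoeffUM mcoeffXU ji mcoeffX mnm1_eq0 !mul0r addr0.
have q0 i : comp_esym2 (q i - ((q i)@_0)%:MP) \in @augmentation K m.
  by rewrite comp_esym2_augmentation mcoeffB mcoeffC eqxx mulr1 subrr.
under eq_bigr do rewrite -[_ *: _]cotangent_piZ.
rewrite -cotangent_pi_sum; apply/cotangent_pi_eq/boolp.asboolP.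
exists [seq (esym2_aug i, AugIdeal (q0 i)) | i <- index_enum 'I_m].
rewrite big_map /=.
transitivity (augideal_val f
  - augideal_val (\sum_i h@_U_(i) *: esym2_aug i)); first by [].
rewrite augideal_val_sum fh {1}hq rmorph_sum -sumrB; apply: eq_bigr=> i _.
rewrite rmorphM /= comp_esym2_XU hU.
transitivity (esym2 K m i.+1 * comp_esym2 (q i)
  - (q i)@_0 *: esym2 K m i.+1); first by [].
have compC : comp_esym2 ((q i)@_0)%:MP = (q i)@_0 *: 1 :> invring K m.
  by rewrite -alg_mpolyC linearZ /= rmorph1.
by rewrite rmorphB /= compC mulrBr -scalerAr mulr1.
Qed.

Hypothesis char2 : (2%:R : K) != 0.

(** Products of polynomials without constant term have no linear part; injectivity of [comp_esym2]
    carries this over to [h]. *)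
Lemma augideal2_comp_esym2 (f : augideal K m) (h : R) (i : 'I_m) :
  augideal_val f = comp_esym2 h -> f \in @augideal2 K m -> h@_U_(i) = 0.
Proof.
move=> fh /boolp.asboolP[s]; rewrite fh => hs.
suff [g sg g0] : exists2 g : R,
    \sum_(p <- s) augideal_val p.1 * augideal_val p.2 = comp_esym2 g
    & g@_U_(i) = 0.
  have /(congr1 val) /= := etrans hs sg.
  by move/comp_esym2_inj ->.
elim/big_ind: _ => [|x y [g -> g0] [k -> k0]|[x y] _].
- by exists 0; rewrite ?rmorph0 ?mcoeff0.
- by exists (g + k); rewrite ?rmorphD // mcoeffD g0 k0 addr0.
have [g xg] := comp_esym2_surj char2 (augideal_val x).
have [k yk] := comp_esym2_surj char2 (augideal_val y).
have /eqP g0 : g@_0 == 0 by rewrite -comp_esym2_augmentation -xg; case: (x).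
have /eqP k0 : k@_0 == 0 by rewrite -comp_esym2_augmentation -yk; case: (y).
exists (g * k); first by rewrite rmorphM /= xg yk.
by rewrite mcoeffUM g0 k0 mulr0 mul0r addr0.
Qed.

(** The coordinates are the linear coefficients of a representative; they are unique because
    elements of the squared ideal have none. *)
Lemma cotangent_basis : is_basis (fun i => cotangent_pi (esym2_aug i)).
Proof.
move=> v; have [h fh] := comp_esym2_surj char2
  (augideal_val (generic_quotient.repr v)).
exists (\row_i h@_U_(i)); split.
  rewrite -[LHS]cotangent_piK (cotangent_pi_comp_esym2 fh).
  by apply: eq_bigr=> i _; rewrite mxE.
move=> c; rewrite -[LHS]cotangent_piK.
under eq_bigr do rewrite -[_ *: _]cotangent_piZ.
rewrite -cotangent_pi_sum => /cotangent_pi_eq; set f := (f in f \in _) => f2.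
have ff : augideal_val f = comp_esym2 (h - \sum_i c 0 i *: 'X_i).
  transitivity (augideal_val (generic_quotient.repr v)
    - augideal_val (\sum_i c 0 i *: esym2_aug i)); first by [].
  rewrite fh augideal_val_sum rmorphB rmorph_sum; congr (_ - _).
  by apply: eq_bigr=> i _; rewrite /= [RHS]linearZ /= comp_esym2_XU.
apply/rowP=> j; rewrite mxE.
have /eqP := augideal2_comp_esym2 j ff f2.
rewrite mcoeffB subr_eq0 => /eqP ->; rewrite raddf_sum (bigD1 j) //=.
rewrite mcoeffZ mcoeffXU eqxx mulr1 big1 ?addr0 // => i /negbTE ij.
by rewrite mcoeffZ mcoeffXU ij mulr0.
Qed.

End Cotangent.

(** * Existence of the operator and its eigenweights *)

Theorem lemma6p1p4 (K : closedFieldType) (charK : [pchar K] =i pred0)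
    (m : nat) (hm : (0 < m)%N) :
  let one : 'I_m := Ordinal hm in
  let mu : 'rV[int]_m := delta_mx 0 one in
  let eta : {mpoly K[m]} := 'X_one ^+ (2 * m) in
  exists nabla : invring K m -> invring K m,
    [/\ is_nabla mu eta nabla,
        (forall i : nat, (1 <= i <= m)%N ->
           nabla (esym2 K m i) = (- 4%:R : K) *: esym2 K m i)
      & exists E : {linear cotangent K m -> cotangent K m},
          induced_on_cotangent nabla E
          /\ eigenvalues_are E (nseq m (- 4%:R : K))].
Proof.
move=> one mu eta.
have char2 : (2%:R : K) != 0.
  by have := charK 2%N; rewrite inE /= => ->.
have comp_nabla h : tofrac (comp_esym2 (nabla_comp_esym2 h) : {mpoly K[m]})
    = pushforward mu (eta * cochar_deriv mu (comp_esym2 h : {mpoly K[m]})).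
  rewrite pushforwardE ?comp_esym2_invariant //.
  exact/esym/sum_pushforward_term_comp_esym2.
(* Boolean equality allows [xchoose] to turn existence into a function. *)
have nabla_ex (f : invring K m) : exists g : invring K m,
    tofrac (g : {mpoly K[m]})
    == pushforward mu (eta * cochar_deriv mu (f : {mpoly K[m]})).
  have [h ->] := comp_esym2_surj char2 f.
  by exists (comp_esym2 (nabla_comp_esym2 h)); apply/eqP/comp_nabla.
pose nabla f := xchoose (nabla_ex f).
have nablaP : is_nabla mu eta nabla.
  by move=> f; apply/eqP/(xchooseP (nabla_ex f)).
have nablaE h : nabla (comp_esym2 h) = comp_esym2 (nabla_comp_esym2 h).
  by apply/val_inj/eqP; rewrite -tofrac_eq nablaP comp_nabla.
exists nabla; split=> //.
  (* The variable of index [i] corresponds to [e_(i+1)], and the Euler operator fixes it. *)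
  case=> // i /= lt_im; rewrite -(comp_esym2_XU K (Ordinal lt_im)) nablaE.
  rewrite -[RHS]linearZ /=.
  congr comp_esym2; rewrite /nabla_comp_esym2 (bigD1 (Ordinal lt_im)) //=.
  rewrite mderivXU eqxx mulr1 big1 => [|j ji]; last first.
    by rewrite mderivXU eq_sym (negbTE ji) mulr0.
  by rewrite addr0 scaleNr scaler_nat mulNrn.
(* The Euler operator preserves linear parts, so the induced map is scaling by -4. *)
exists (GRing.scale (- 4%:R : K)); split.
  move=> f; have [h fh] := comp_esym2_surj char2 (augideal_val f).
  have g0 : comp_esym2 (nabla_comp_esym2 h) \in @augmentation K m.
    rewrite comp_esym2_augmentation mcoeffMn mcoeffN raddf_sum big1.
      by rewrite oppr0 mul0rn.
    by move=> i _; rewrite /= rmorphM /= mcoeffX mnm1_eq0 mul0r.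
  exists (AugIdeal g0); first by rewrite fh nablaE.
  rewrite (cotangent_pi_comp_esym2 fh).
  rewrite (cotangent_pi_comp_esym2 (f := AugIdeal g0) (erefl _)).
  rewrite /= scaler_sumr; apply: eq_bigr=> i _; rewrite scalerA; congr (_ *: _).
  rewrite mcoeffMn mcoeffN raddf_sum (bigD1 i) //= mcoeffUM mcoeffXU eqxx.
  rewrite mcoeffX mnm1_eq0 mul0r mul1r addr0 -mcoeffU_mderiv big1 ?addr0.
    by rewrite mulNr mulr_natl mulNrn.
  move=> j /negbTE ji.
  by rewrite mcoeffUM mcoeffXU ji mcoeffX mnm1_eq0 !mul0r addr0.
(* In the basis of classes of the [e_i] the matrix is scalar, with characteristic polynomial
   [(X + 4)^m]. *)
exists m, (fun i => cotangent_pi (esym2_aug K i)), (- 4%:R)%:M.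
split=> [|j|]; first exact: cotangent_basis.
  rewrite (bigD1 j) //= mxE eqxx mulr1n big1 ?addr0 // => i /negbTE ij.
  by rewrite mxE ij mulr0n scale0r.
rewrite /char_poly /char_poly_mx map_scalar_mx -raddfB det_scalar.
by rewrite big_nseq -Monoid.iteropE.
Qed.
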